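(* For every integer $n\geq 0$, the elements $A^iB^jC^k\alpha^r\beta^s\gamma^t$ with $i,j,k,r,s,t\geq 0$ and $i+j+k+r+s+t\leq n$ form a basis for the $\mathbb F$-vector space $\Delta_n$.
   Context: Let $\mathbb F$ be a field and fix a nonzero $q\in\mathbb F$ with $q^4\neq 1$. The universal Askey--Wilson algebra $\Delta$ is the associative $\mathbb F$-algebra with 1 with generators $A,B,C$ subject to the relations that each of $A+\frac{qBC-q^{-1}CB}{q^2-q^{-2}}$, $B+\frac{qCA-q^{-1}AC}{q^2-q^{-2}}$, $C+\frac{qAB-q^{-1}BA}{q^2-q^{-2}}$ is central; $\alpha,\beta,\gamma$ denote these three central elements (in order) each multiplied by $q+q^{-1}$. For subspaces $H,K$ let $HK$ be the span of all $hk$, $h\in H$, $k\in K$. Define subspaces $\Delta_0=\mathbb F1$, $\Delta_1=\Delta_0+{\rm Span}\{A,B,C,\alpha,\beta,\gamma\}$, and $\Delta_n=\Delta_1\Delta_{n-1}$ for $n\geq 1$. *)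

(* Defs.v *)
From HB Require Import structures.
From mathcomp Require Import all_boot all_order all_algebra.
Set Implicit Arguments. Unset Strict Implicit. Unset Printing Implicit Defensive.
Import Order.TTheory GRing.Theory Num.Theory.
Local Open Scope ring_scope.

Section AW.
Variables (F : fieldType) (q : F).

Section InAlg.
Variable (D : algType F).

Definition aw_elt (X Y Z : D) : D :=
  X + (q ^+ 2 - q^-1 ^+ 2)^-1 *: (q *: (Y * Z) - q^-1 *: (Z * Y)).

Definition aw_a (A B C : D) := aw_elt A B C.
Definition aw_b (A B C : D) := aw_elt B C A.
Definition aw_c (A B C : D) := aw_elt C A B.

Definition aw_alpha (A B C : D) := (q + q^-1) *: aw_a A B C.
Definition aw_beta  (A B C : D) := (q + q^-1) *: aw_b A B C.
Definition aw_gamma (A B C : D) := (q + q^-1) *: aw_c A B C.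

Definition central (x : D) : Prop := forall y : D, x * y = y * x.

Definition comm_gens (A B C x : D) : Prop :=
  [/\ x * A = A * x, x * B = B * x & x * C = C * x].

Definition aw_rel (A B C : D) : Prop :=
  [/\ comm_gens A B C (aw_a A B C), comm_gens A B C (aw_b A B C)
    & comm_gens A B C (aw_c A B C)].

Definition span (S : D -> Prop) (x : D) : Prop :=
  exists (m : nat) (c : 'I_m -> F) (v : 'I_m -> D),
    (forall i, S (v i)) /\ x = \sum_(i < m) c i *: v i.

Definition prodsp (H K : D -> Prop) : D -> Prop :=
  span (fun y => exists h k, [/\ H h, K k & y = h * k]).

Definition Delta0 : D -> Prop := span (fun y => y = 1).

Definition Delta1 (A B C : D) : D -> Prop :=
  span (fun y => y = 1 \/ y = A \/ y = B \/ y = C \/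
                 y = aw_alpha A B C \/ y = aw_beta A B C \/ y = aw_gamma A B C).

Fixpoint Delta (A B C : D) (n : nat) : D -> Prop :=
  match n with
  | 0 => Delta0
  | n'.+1 => prodsp (Delta1 A B C) (Delta A B C n')
  end.

Definition expo (n : nat) : finType :=
  ('I_n.+1 * 'I_n.+1 * 'I_n.+1 * 'I_n.+1 * 'I_n.+1 * 'I_n.+1)%type.

Definition expo_sum n (e : expo n) : nat :=
  let: (i, j, k, r, s, t) := e in
  (nat_of_ord i + nat_of_ord j + nat_of_ord k + nat_of_ord r
     + nat_of_ord s + nat_of_ord t)%N.

Definition expo_ok n : pred (expo n) := fun e => (expo_sum e <= n)%N.

Definition aw_mono (A B C : D) n (e : expo n) : D :=
  let: (i, j, k, r, s, t) := e in
  A ^+ i * B ^+ j * C ^+ k * aw_alpha A B C ^+ r * aw_beta A B C ^+ s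
    * aw_gamma A B C ^+ t.

Definition is_basis_of (P : D -> Prop) (I : finType) (J : pred I) (v : I -> D)
  : Prop :=
  (forall x, P x <-> exists c : I -> F, x = \sum_(i | J i) c i *: v i) /\
  (forall c : I -> F, \sum_(i | J i) c i *: v i = 0 -> forall i, J i -> c i = 0).

End InAlg.

(** (D, A, B, C) is the universal Askey--Wilson algebra: the relations hold
    (the three elements are central in D), and D is initial among F-algebras
    with three elements satisfying the defining relations. *)
Definition is_universal_AW (D : algType F) (A B C : D) : Prop :=
  [/\ central (aw_a A B C), central (aw_b A B C), central (aw_c A B C),
      (forall (E : algType F) (a b c : E), aw_rel a b c ->
         exists f : {lrmorphism D -> E}, [/\ f A = a, f B = b & f C = c])
    & (forall (E : algType F) (f g : {lrmorphism D -> E}),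
         f A = g A -> f B = g B -> f C = g C -> forall x, f x = g x)].

End AW.

(* Main.v *)
Require Import Defs.
From HB Require Import structures.
From mathcomp Require Import all_boot all_order all_algebra.
From mathcomp Require Import ring zify boolp functions.
From mathcomp Require Import mpoly.
Import GRing.Theory.
Set Implicit Arguments. Unset Strict Implicit. Unset Printing Implicit Defensive.
Local Open Scope ring_scope.

(* The defining relations rewrite B A, C A, C B into ordered monomials modulo
   terms of lower degree, which gives spanning together with the filtration.
   For independence, let R = F[lam, al, be, ga] and let f range over the R-valued
   functionals on Delta with f (A y) = lam f(y), on which Delta acts by
   (x f)(y) = f (y x).  Such an f is recorded as the array f j k = f (B^j C^k).
   The relations dictate how A, B, C act on arrays, and conversely the operators
   so defined satisfy the relations.  By universality Delta acts on arrays, and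
   (A^i B^j C^k alpha^r beta^s gamma^t f) 0 0 = lam^i al^r be^s ga^t f j k
   separates the monomials. *)

(** * The algebra of linear endomorphisms of a module *)

Section EndomorphismAlgebra.
Variables (K : comNzRingType) (V : lmodType K).

(** A boolean predicate, by classical reflection, so that linear maps form a subtype of [V -> V] and
    inherit its module structure. *)
Definition linear_map : {pred V -> V} := fun f => `[< linear f >].

Lemma linear_mapP f : reflect (linear f) (f \in linear_map).
Proof. exact: asboolP. Qed.

Lemma linear_map_submod_closed : submod_closed linear_map.
Proof.
split=> [|c f g /linear_mapP lf /linear_mapP lg]; apply/linear_mapP => a u v.
  by rewrite /= scaler0 addr0.
rewrite /= !fctE lf lg !scalerDr !scalerA [a * c]mulrC -!addrA; congr (_ + _).
by rewrite addrCA.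
Qed.

HB.instance Definition _ :=
  GRing.isSubmodClosed.Build K (V -> V) linear_map linear_map_submod_closed.

Record endo : Type := Endo { endo_fun :> V -> V; _ : endo_fun \in linear_map }.

HB.instance Definition _ := [isSub of endo for endo_fun].
HB.instance Definition _ := [Choice of endo by <:].
HB.instance Definition _ := [SubChoice_isSubLmodule of endo by <:].


Lemma endo_linear (f : endo) (c : K) u v : f (c *: u + v) = c *: f u + f v.
Proof. by case: f => f /= /linear_mapP lf; apply: lf. Qed.

Lemma endo_ext (f g : endo) : (forall u, f u = g u) -> f = g.
Proof. by move=> fg; apply/val_inj/funext. Qed.

Lemma endo_id_subproof : idfun \in linear_map.
Proof. exact/linear_mapP. Qed.

Lemma endo_comp_subproof (f g : endo) : f \o g \in linear_map.
Proof. by apply/linear_mapP => a u v; rewrite /= !endo_linear. Qed.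

Definition endo_id := Endo endo_id_subproof.
Definition endo_comp (f g : endo) := Endo (endo_comp_subproof f g).

Lemma endoD (f g : endo) u : (f + g) u = f u + g u. Proof. by []. Qed.
Lemma endo_vecD (f : endo) u v : f (u + v) = f u + f v.
Proof. by rewrite -[u]scale1r endo_linear !scale1r. Qed.
Lemma endo_vecZ (f : endo) c u : f (c *: u) = c *: f u.
Proof.
have f0 : f 0 = 0 by apply: (addIr (f 0)); rewrite -endo_vecD !add0r.
by rewrite -[c *: u]addr0 endo_linear f0 addr0.
Qed.

(* The unit ring axiom 1 != 0 needs V != 0, so the algebra carries a nonzero
   vector as a parameter. *)
Definition endo_alg (v0 : V) of v0 != 0 := endo.

Variables (v0 : V) (v0_neq0 : v0 != 0).
Local Notation E := (endo_alg v0_neq0).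

HB.instance Definition _ := GRing.Lmodule.on E.

Lemma endo_compA : associative endo_comp.
Proof. by move=> f g h; apply: endo_ext. Qed.
Lemma endo_comp1f : left_id endo_id endo_comp.
Proof. by move=> f; apply: endo_ext. Qed.
Lemma endo_compf1 : right_id endo_id endo_comp.
Proof. by move=> f; apply: endo_ext. Qed.
Lemma endo_compDl : left_distributive endo_comp (+%R : E -> E -> E).
Proof. by move=> f g h; apply: endo_ext. Qed.
Lemma endo_compDr : right_distributive endo_comp (+%R : E -> E -> E).
Proof. by move=> f g h; apply: endo_ext => u; rewrite endoD /= endo_vecD. Qed.
Lemma endo_id_neq0 : endo_id != 0 :> E.
Proof.
by apply: contra v0_neq0 => /eqP E0; apply/eqP; have := congr1 (@^~ v0 \o endo_fun) E0.
Qed.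

HB.instance Definition _ := GRing.Zmodule_isNzRing.Build E
  endo_compA endo_comp1f endo_compf1 endo_compDl endo_compDr endo_id_neq0.

Lemma endo_scalerAl (c : K) (f g : E) : c *: (f * g) = c *: f * g.
Proof. by apply: endo_ext. Qed.
HB.instance Definition _ := GRing.Lmodule_isLalgebra.Build K E endo_scalerAl.

Lemma endo_scalerAr (c : K) (f g : E) : c *: (f * g) = f * (c *: g).
Proof. by apply: endo_ext => u; exact: (esym (endo_vecZ f c (g u))). Qed.
HB.instance Definition _ := GRing.Lalgebra_isAlgebra.Build K E endo_scalerAr.

Lemma endoM (f g : E) u : (f * g) u = f (g u). Proof. by []. Qed.
Lemma endoX (f : E) n u : (f ^+ n) u = iter n f u.
Proof. by elim: n => // n IHn; rewrite exprS endoM IHn. Qed.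

End EndomorphismAlgebra.

(** * Operators on arrays dictated by the commutation rules *)

Section DualModule.
Variables (R : comNzRingType) (Q Qi lam al be ga : R).
Hypothesis QQi : Q * Qi = 1.
Local Notation P := (Q ^+ 2 - Qi ^+ 2).
Local Notation M := (Q - Qi).
Local Notation V := (nat -> nat -> R).

Implicit Types f g : V.

Definition shift f : V := fun j k => f j k.+1.
(** Coefficients range over [R]: linearity over [R] makes multiplication by [al], [be], [ga] commute
    with the operators, and scalars [c%:A] give linearity over [F]. *)
Definition lincomb (r : R) f g : V := fun j k => r * f j k + g j k.

(* Column j of (A f, B f), by the commutation rules for C A and C B, from the
   value [a f] of A f at (j, 0). *)
Fixpoint col (a : V -> R) (j k : nat) f : R * R :=
  match k with
  | 0 => (a f, f j.+1 0)
  | k'.+1 =>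
    (Qi ^+ 2 * (col a j k' (shift f)).1 - Qi * P * (col a j k' f).2
       + Qi * M * be * f j k',
     Q ^+ 2 * (col a j k' (shift f)).2 + Q * P * (col a j k' f).1
       - Q * M * al * f j k')
  end.

(* The value of A f at (j, 0), by the commutation rule for B A; it only reads
   columns 0, ..., j of f, so that any fuel d >= j gives the same result. *)
Fixpoint base (d j : nat) f : R :=
  match d, j with
  | d'.+1, j'.+1 =>
    Q ^+ 2 * base d' j' (fun i k => (col (base d' i) i k f).2)
      + Q * P * f j' 1 - Q * M * ga * f j' 0
  | _, _ => lam * f 0 0
  end.

Definition opA f : V := fun j k => (col (base j j) j k f).1.
Definition opB f : V := fun j k => (col (base j j) j k f).2.

Definition reads_upto (j : nat) (a : V -> R) :=
  forall f g, (forall i k, (i <= j)%N -> f i k = g i k) -> a f = a g.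

(** The bound rises from [j] to [j.+1] because the second component starts from [f j.+1 0]. *)
Lemma col_local a j k f g : reads_upto j a ->
  (forall i l, (i <= j.+1)%N -> f i l = g i l) -> col a j k f = col a j k g.
Proof.
move=> ja; elim: k f g => [|k IHk] f g fg /=.
  by rewrite fg // (ja f g) // => i l ij; rewrite fg // leqW.
rewrite (IHk f g) // (IHk (shift f) (shift g)) ?fg // => i l ij.
exact: fg.
Qed.

Lemma base_local d j : reads_upto j (base d j).
Proof.
elim: d j => [|d IHd] [|j] f g fg /=; rewrite ?fg //.
rewrite (IHd j _ (fun i k => (col (base d i) i k g).2)) // => i k ij.
by rewrite (@col_local _ _ _ f g) // => i' l ij'; rewrite fg // (leq_trans ij').
Qed.

Lemma base_stableS d j : (j <= d)%N -> base d.+1 j = base d j.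
Proof.
elim: d j => [|d IHd] [|j] // jd; apply/funext => f.
rewrite -[LHS]/(Q ^+ 2 * base d.+1 j (fun i k => (col (base d.+1 i) i k f).2)
      + Q * P * f j 1 - Q * M * ga * f j 0) IHd //=.
(* The induction hypothesis changes the inner fuel only for [i <= d]; locality restricts the
   comparison to the columns [i <= j], where it applies. *)
congr (_ * _ + _ - _); apply: base_local => i k ij.
by rewrite -IHd // (leq_trans ij).
Qed.

Lemma base_stable d j : (j <= d)%N -> base d j = base j j.
Proof.
by move=> /subnK <-; elim: (d - j)%N => // n IHn; rewrite addSn base_stableS ?leq_addl.
Qed.

Lemma opA00 f : opA f 0 0 = lam * f 0 0. Proof. by []. Qed.
Lemma opB0 f j : opB f j 0 = f j.+1 0. Proof. by []. Qed.

Lemma opAS f j k : opA f j k.+1 =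
  Qi ^+ 2 * opA (shift f) j k - Qi * P * opB f j k + Qi * M * be * f j k.
Proof. by []. Qed.

Lemma opBS f j k : opB f j k.+1 =
  Q ^+ 2 * opB (shift f) j k + Q * P * opA f j k - Q * M * al * f j k.
Proof. by []. Qed.

(** The rule for B A freed from fuel: [base] computes every inner column with fuel [j], whereas
    [opB] uses fuel [i] in column [i], and [base_stable] identifies the two on the columns that are
    read. *)
Lemma opAS0 f j : opA f j.+1 0 =
  Q ^+ 2 * opA (opB f) j 0 + Q * P * f j 1 - Q * M * ga * f j 0.
Proof.
rewrite /opA /=; congr (_ * _ + _ - _); apply: base_local => i k ij.
by rewrite /opB base_stable.
Qed.

Definition Rlinear (a : V -> R) :=
  forall r f g, a (lincomb r f g) = r * a f + a g.

(** Both components go through one induction, since each recurrence involves the other. *)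
Lemma col_linear a j k : Rlinear a ->
  Rlinear (fun f => (col a j k f).1) /\ Rlinear (fun f => (col a j k f).2).
Proof.
move=> la; elim: k => [|k [IH1 IH2]]; split=> r f g //=;
  have -> : shift (lincomb r f g) = lincomb r (shift f) (shift g) by [];
  rewrite !IH1 !IH2 /lincomb; ring.
Qed.

Lemma base_linear d j : Rlinear (base d j).
Proof.
elim: d j => [|d IHd] [|j] r f g /=; try by rewrite /lincomb; ring.
have -> : (fun i k => (col (base d i) i k (lincomb r f g)).2) =
  lincomb r (fun i k => (col (base d i) i k f).2)
            (fun i k => (col (base d i) i k g).2).
  by apply/funext => i; apply/funext => k; rewrite (proj2 (col_linear i k (IHd i))).
rewrite IHd /lincomb; ring.
Qed.

Lemma opA_linear r f g : opA (lincomb r f g) = lincomb r (opA f) (opA g).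
Proof.
apply/funext => j; apply/funext => k.
exact: (proj1 (col_linear j k (base_linear j j))).
Qed.

Lemma opB_linear r f g : opB (lincomb r f g) = lincomb r (opB f) (opB g).
Proof.
apply/funext => j; apply/funext => k.
exact: (proj2 (col_linear j k (base_linear j j))).
Qed.

(** The rule for C A as an equation between whole arrays, to which [opB] can then be applied by
    linearity; [shift_opB] does the same for C B. *)
Lemma shift_opA f : shift (opA f) =
  lincomb (Qi ^+ 2) (opA (shift f))
    (lincomb (- (Qi * P)) (opB f) (lincomb (Qi * M * be) f (fun _ _ => 0))).
Proof.
by apply/funext => j; apply/funext => k; rewrite /shift opAS /lincomb; ring.
Qed.

Lemma shift_opB f : shift (opB f) =
  lincomb (Q ^+ 2) (opB (shift f))
    (lincomb (Q * P) (opA f) (lincomb (- (Q * M * al)) f (fun _ _ => 0))).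
Proof.
by apply/funext => j; apply/funext => k; rewrite /shift opBS /lincomb; ring.
Qed.

Lemma opA0 : opA (fun _ _ => 0) = fun _ _ => 0.
Proof.
(* Writing 0 as (-1) 0 + 0, linearity turns the left side into - [opA] 0 + [opA] 0. *)
have -> : (fun _ _ => 0) = lincomb (-1) (fun _ _ => 0) (fun _ _ => 0) :> V.
  by apply/funext => j; apply/funext => k; rewrite /lincomb mulr0 addr0.
rewrite opA_linear /lincomb; apply/funext => j; apply/funext => k; ring.
Qed.

Lemma opB_zero : opB (fun _ _ => 0) = fun _ _ => 0.
Proof.
have -> : (fun _ _ => 0) = lincomb (-1) (fun _ _ => 0) (fun _ _ => 0) :> V.
  by apply/funext => j; apply/funext => k; rewrite /lincomb mulr0 addr0.
rewrite opB_linear /lincomb; apply/funext => j; apply/funext => k; ring.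
Qed.

(* The defect of this relation commutes with [shift] (this is the resolution
   of the overlap C B A), so it vanishes because it does at k = 0. *)
Lemma opBA f j k : opB (opA f) j k =
  Q ^+ 2 * opA (opB f) j k + Q * P * f j k.+1 - Q * M * ga * f j k.
Proof.
elim: k f => [|k IHk] f; first by rewrite opB0 opAS0.
rewrite opBS opAS shift_opA shift_opB !opA_linear !opB_linear opA0 opB_zero.
rewrite /lincomb IHk /shift.
have e1 : Q ^+ 2 * Qi ^+ 2 = 1 by rewrite -exprMn QQi expr1n.
have e2 : Q ^+ 2 * Qi = Q by rewrite expr2 -mulrA QQi mulr1.
ring: e1 e2.
Qed.

End DualModule.

(** * The Askey-Wilson relations for the operators on arrays *)

Section DualRepresentation.
Variables (F : fieldType) (q : F) (R : comAlgType F) (lam al be ga : R).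
Hypotheses (q_neq0 : q != 0) (q4_neq1 : q ^+ 4 != 1).
Local Notation Q := (q%:A : R).
Local Notation Qi := (q^-1%:A : R).
Local Notation V := (nat -> nat -> R).
Local Notation A_op := (opA Q Qi lam al be ga).
Local Notation B_op := (opB Q Qi lam al be ga).

Lemma one_fun_neq0 : (fun _ _ => 1) != 0 :> V.
Proof.
apply/eqP => /(congr1 (fun f : V => f 0 0)) /= /eqP.
by rewrite (negPf (oner_neq0 R)).
Qed.

Local Notation E := (endo_alg one_fun_neq0).

Lemma lincomb_fctE (c : F) (f g : V) : c *: f + g = lincomb c%:A f g.
Proof.
by apply/funext => j; apply/funext => k; rewrite /lincomb mulr_algl.
Qed.

Lemma A_op_linear : A_op \in @linear_map F V.
Proof. by apply/linear_mapP => c f g; rewrite !lincomb_fctE opA_linear. Qed.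

Lemma B_op_linear : B_op \in @linear_map F V.
Proof. by apply/linear_mapP => c f g; rewrite !lincomb_fctE opB_linear. Qed.

Lemma shift_linear : @shift R \in @linear_map F V.
Proof. by apply/linear_mapP => c f g; rewrite !lincomb_fctE. Qed.

Definition mul_op (r : R) : V -> V := fun f j k => r * f j k.

Lemma mul_op_linear r : mul_op r \in @linear_map F V.
Proof.
apply/linear_mapP => c f g; rewrite !lincomb_fctE.
by apply/funext => j; apply/funext => k; rewrite /mul_op /lincomb mulrDr mulrCA.
Qed.

Definition eA : E := Endo A_op_linear.
Definition eB : E := Endo B_op_linear.
Definition eC : E := Endo shift_linear.
Definition eM r : E := Endo (mul_op_linear r).

Lemma q_inv : Q * Qi = 1.
Proof. by rewrite mulr_algl scalerA mulfV // scale1r. Qed.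

Lemma q2_sub_neq0 : q ^+ 2 - q^-1 ^+ 2 != 0.
Proof.
apply: contra q4_neq1; rewrite subr_eq0 => /eqP q2.
by rewrite (exprD q 2 2) {1}q2 -exprMn mulVf // expr1n.
Qed.

Local Notation p := (q ^+ 2 - q^-1 ^+ 2).

Lemma algM (a b : F) : (a * b)%:A = a%:A * b%:A :> R.
Proof. by rewrite mulr_algl scalerA. Qed.

Lemma p_inv : (p^-1%:A : R) * (Q ^+ 2 - Qi ^+ 2) = 1.
Proof.
rewrite !expr2 -!algM -scalerBl -algM -!expr2 mulVf ?scale1r //.
exact: q2_sub_neq0.
Qed.

(** This is the inverse of q + q^-1, because q^2 - q^-2 = (q - q^-1)(q + q^-1); this form matches
    the coefficients of the recurrences. *)
Definition kap : F := p^-1 * (q - q^-1).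

Lemma kapA : kap%:A = (p^-1)%:A * (Q - Qi) :> R.
Proof. by rewrite algM scalerBl. Qed.

Lemma kap_sum : (q + q^-1) * kap = 1.
Proof.
rewrite /kap mulrCA [X in _ * X]mulrC -subr_sqr mulVf //; exact: q2_sub_neq0.
Qed.

Lemma eMZ c r : c *: eM r = eM (c%:A * r).
Proof.
apply: endo_ext => f; apply/funext => j; apply/funext => k.
by rewrite /= /mul_op -mulrA mulr_algl.
Qed.

Lemma endo_ext2 (x y : E) : (forall f j k, x f j k = y f j k) -> x = y.
Proof. by move=> xy; apply: endo_ext => f; apply/funext => j; apply/funext. Qed.

Lemma aw_eltE (X Y Z : E) f j k :
  aw_elt q X Y Z f j k = X f j k + (p^-1)%:A *
    (Q * Y (Z f) j k - Qi * Z (Y f) j k).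
Proof.
by rewrite !mulr_algl.
Qed.

(** The recurrence [opBS] is the alpha relation solved for C B; substituting it back cancels
    everything but the term in [al]. The next two lemmas use [opAS] and [opBA] in the same way. *)
Lemma aw_a_rep : aw_a q eA eB eC = eM (kap%:A * al).
Proof.
apply: endo_ext2 => f j k; rewrite aw_eltE kapA /= /mul_op.
rewrite {2}/shift opBS.
have e1 := q_inv; have e2 := p_inv.
have e3 : Qi * (Q * Q) = Q by rewrite mulrA [Qi * _]mulrC e1 mul1r.
(* With [P] opaque, the left side of [e2] no longer expands in [Q] and [Qi], so [ring] can use it as
   a rewriting rule. *)
set P := Q ^+ 2 - _ in e2 *; clearbody P.
ring: e1 e2 e3.
Qed.

Lemma aw_b_rep : aw_b q eA eB eC = eM (kap%:A * be).
Proof.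
apply: endo_ext2 => f j k; rewrite aw_eltE kapA /= /mul_op.
rewrite {1}/shift opAS.
have e1 := q_inv; have e2 := p_inv.
have e3 : Q * Qi ^+ 2 = Qi by rewrite expr2 mulrA e1 mul1r.
set P := Q ^+ 2 - _ in e2 *; clearbody P.
ring: e1 e2 e3.
Qed.

Lemma aw_c_rep : aw_c q eA eB eC = eM (kap%:A * ga).
Proof.
apply: endo_ext2 => f j k; rewrite aw_eltE kapA /= /mul_op.
rewrite opBA ?q_inv // /shift.
have e1 := q_inv; have e2 := p_inv.
have e3 : Qi * Q ^+ 2 = Q by rewrite expr2 mulrA [Qi * _]mulrC e1 mul1r.
set P := Q ^+ 2 - _ in e2 *; clearbody P.
ring: e1 e2 e3.
Qed.

Lemma eM_comm r : comm_gens eA eB eC (eM r).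
Proof.
(* Multiplication by [r] becomes a combination with the zero array, so that linearity over [R] gives
   the commutation. *)
have lin0 f : mul_op r f = lincomb r f (fun _ _ => 0).
  by apply/funext => j; apply/funext => k; rewrite /lincomb addr0.
split; apply: endo_ext => f; rewrite !endoM /= ?lin0 //.
  by rewrite opA_linear opA0.
by rewrite opB_linear opB_zero.
Qed.

Lemma aw_rel_rep : aw_rel q eA eB eC.
Proof. by split; rewrite ?aw_a_rep ?aw_b_rep ?aw_c_rep; apply: eM_comm. Qed.

Lemma sum_kap_eM r : (q + q^-1) *: eM (kap%:A * r) = eM r.
Proof. by rewrite eMZ mulrA -algM kap_sum scale1r mul1r. Qed.

Lemma aw_alpha_rep : aw_alpha q eA eB eC = eM al.
Proof. by rewrite /aw_alpha aw_a_rep sum_kap_eM. Qed.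
Lemma aw_beta_rep : aw_beta q eA eB eC = eM be.
Proof. by rewrite /aw_beta aw_b_rep sum_kap_eM. Qed.
Lemma aw_gamma_rep : aw_gamma q eA eB eC = eM ga.
Proof. by rewrite /aw_gamma aw_c_rep sum_kap_eM. Qed.

Lemma iter_A_op i f : iter i A_op f 0 0 = lam ^+ i * f 0 0.
Proof.
elim: i => [|i IHi]; first by rewrite mul1r.
by rewrite iterS opA00 IHi exprS mulrA.
Qed.

Lemma iter_B_op i f j : iter i B_op f j 0 = f (i + j)%N 0.
Proof.
by elim: i j => // i IHi j; rewrite iterS opB0 IHi addSnnS.
Qed.

Lemma iter_shift i f j k : iter i (@shift R) f j k = f j (i + k)%N.
Proof.
by elim: i k => // i IHi k; rewrite iterS /shift IHi addSnnS.
Qed.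

Lemma iter_mul_op i r f : iter i (mul_op r) f = mul_op (r ^+ i) f.
Proof.
elim: i => [|i IHi]; apply/funext => j; apply/funext => k.
  by rewrite /mul_op mul1r.
by rewrite iterS IHi /mul_op exprS mulrA.
Qed.

(** The order of the factors makes the value explicit: the outermost [eA ^+ i] is read at (0, 0),
    where it multiplies by [lam ^+ i]; then [eB ^+ j] is read at second index 0, where it shifts the
    first index; [eC ^+ k] shifts the second. *)
Lemma mono_rep i j k r s t f :
  (eA ^+ i * eB ^+ j * eC ^+ k * aw_alpha q eA eB eC ^+ r
    * aw_beta q eA eB eC ^+ s * aw_gamma q eA eB eC ^+ t) f 0 0 =
  lam ^+ i * al ^+ r * be ^+ s * ga ^+ t * f j k.
Proof.
rewrite aw_alpha_rep aw_beta_rep aw_gamma_rep !endoM !endoX.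
rewrite iter_A_op iter_B_op iter_shift !iter_mul_op /mul_op !addn0; ring.
Qed.

End DualRepresentation.

(** * Closure properties of spans in an algebra *)

Local Notation span := Defs.span.

Section Span.
Variables (F : fieldType) (D : algType F).
Implicit Types (S T : D -> Prop) (x y : D).

Lemma span_gen S x : S x -> span S x.
Proof.
by move=> Sx; exists 1%N, (fun=> 1), (fun=> x); split=> //; rewrite big_ord1 scale1r.
Qed.

Lemma span0 S : span S 0.
Proof.
by exists 0%N, (fun=> 0), (fun=> 0); split=> [[]//|]; rewrite big_ord0.
Qed.

Lemma spanD S x y : span S x -> span S y -> span S (x + y).
Proof.
move=> [m1 [c1 [v1 [h1 ->]]]] [m2 [c2 [v2 [h2 ->]]]].
exists (m1 + m2)%N, (fun i => match fintype.split i with inl j => c1 j | inr j => c2 j end),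
  (fun i => match fintype.split i with inl j => v1 j | inr j => v2 j end).
split=> [i|]; first by case: (fintype.split i).
rewrite big_split_ord /=; congr (_ + _); apply: eq_bigr => i _.
  by rewrite (unsplitK (inl i)).
by rewrite (unsplitK (inr i)).
Qed.

Lemma spanZ S c x : span S x -> span S (c *: x).
Proof.
move=> [m [d [v [h ->]]]]; exists m, (fun i => c * d i), v; split=> //.
by rewrite scaler_sumr; apply: eq_bigr => i _; rewrite scalerA.
Qed.

Lemma spanB S x y : span S x -> span S y -> span S (x - y).
Proof. by move=> hx hy; rewrite -scaleN1r; apply: spanD => //; apply: spanZ. Qed.

Lemma span_sum S (I : finType) (J : pred I) (c : I -> F) (v : I -> D) :
  (forall i, J i -> S (v i)) -> span S (\sum_(i | J i) c i *: v i).
Proof.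
move=> h; elim/big_ind: _ => [||i Ji]; first exact: span0.
  exact: spanD.
by apply/spanZ/span_gen/h.
Qed.

Lemma span_min S T :
  T 0 -> (forall c x y, T x -> T y -> T (c *: x + y)) ->
  (forall x, S x -> T x) -> forall x, span S x -> T x.
Proof.
move=> T0 TD ST x [m [c [v [h ->]]]].
elim/big_rec: _ => // i y _; apply: TD; exact: ST.
Qed.

Lemma span_mull S T z : (forall x, S x -> span T (z * x)) ->
  forall x, span S x -> span T (z * x).
Proof.
move=> h; apply: span_min => //; first by rewrite mulr0; apply: span0.
by move=> c x y hx hy; rewrite mulrDr -scalerAr; apply/spanD/hy/spanZ.
Qed.

Lemma span_mulr S T z : (forall x, S x -> span T (x * z)) ->
  forall x, span S x -> span T (x * z).
Proof.
move=> h; apply: span_min => //; first by rewrite mul0r; apply: span0.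
by move=> c x y hx hy; rewrite mulrDl -scalerAl; apply/spanD/hy/spanZ.
Qed.

Lemma span_sub S T : (forall x, S x -> span T x) ->
  forall x, span S x -> span T x.
Proof.
move=> h; apply: span_min => //; first exact: span0.
by move=> c x y hx hy; apply/spanD/hy/spanZ.
Qed.

End Span.

(** * Ordered monomials span each term of the filtration *)

Section Spanning.
Variables (F : fieldType) (q : F) (D : algType F) (A B C : D).
Hypotheses (q_neq0 : q != 0) (q4_neq1 : q ^+ 4 != 1).
Hypotheses (cent_a : central (aw_a q A B C)) (cent_b : central (aw_b q A B C))
  (cent_c : central (aw_c q A B C)).

Local Notation p := (q ^+ 2 - q^-1 ^+ 2).
Local Notation al := (aw_alpha q A B C).
Local Notation be := (aw_beta q A B C).
Local Notation ga := (aw_gamma q A B C).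

Lemma central_scale c (x : D) : central x -> central (c *: x).
Proof. by move=> cx y; rewrite -scalerAl cx scalerAr. Qed.

(** The coefficients stay existential because the degree argument only needs that a swap costs
    multiples of [X] and of the rescaled relation element. *)
Lemma aw_elt_swap (X Y Z : D) : exists c d e : F,
  Z * Y = c *: (Y * Z) + d *: X - e *: ((q + q^-1) *: aw_elt q X Y Z).
Proof.
have p0 := q2_sub_neq0 q_neq0 q4_neq1.
(* With xi the rescaled element, p X + q Y Z - q^-1 Z Y = (q - q^-1) xi; this is solved for Z Y. *)
exists (q ^+ 2), (q * p), (q * (q - q^-1)); rewrite /aw_elt.
rewrite scalerA.
have -> : q * (q - q^-1) * (q + q^-1) = q * p by rewrite -mulrA -subr_sqr.
rewrite scalerDr opprD addrA addrK scalerA -mulrA mulfV // mulr1.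
rewrite scalerBr !scalerA mulfV // scale1r -expr2 opprB addrC subrK //.
Qed.

(** Needed for the beta relation, where the product out of order is C A, that is Y Z; for alpha and
    gamma it is Z Y. *)
Lemma aw_elt_swapV (X Y Z : D) : exists c d e : F,
  Y * Z = c *: (Z * Y) + d *: X - e *: ((q + q^-1) *: aw_elt q X Y Z).
Proof.
have p0 := q2_sub_neq0 q_neq0 q4_neq1.
exists (q^-1 ^+ 2), (- (q^-1 * p)), (- (q^-1 * (q - q^-1))); rewrite /aw_elt.
rewrite scalerA.
have -> : - (q^-1 * (q - q^-1)) * (q + q^-1) = - (q^-1 * p).
  by rewrite mulNr -mulrA -subr_sqr.
rewrite scalerDr opprD addrA addrK !scaleNr opprK scalerA -mulrA mulfV // mulr1.
rewrite scalerBr !scalerA mulVf // scale1r -expr2 addrC subrK //.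
Qed.

(** Exponents are plain naturals, not ordinals bounded by the degree as in [aw_mono], so that
    inductions can change the degree. *)
Definition mono i j k r s t : D :=
  A ^+ i * B ^+ j * C ^+ k * al ^+ r * be ^+ s * ga ^+ t.

Definition is_mono n (x : D) : Prop := exists i j k r s t : nat,
  (i + j + k + r + s + t <= n)%N /\ x = mono i j k r s t.

Local Notation Mspan n := (span (is_mono n)).

Lemma is_mono_leq m n x : (m <= n)%N -> is_mono m x -> is_mono n x.
Proof.
move=> mn [i [j [k [r [s [t [h ->]]]]]]]; exists i, j, k, r, s, t.
by split=> //; apply: leq_trans mn.
Qed.

Lemma Mspan_leq m n x : (m <= n)%N -> Mspan m x -> Mspan n x.
Proof. by move=> mn; apply: span_sub => y /(is_mono_leq mn)/span_gen. Qed.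

Lemma cent_al : central al. Proof. exact: central_scale. Qed.
Lemma cent_be : central be. Proof. exact: central_scale. Qed.
Lemma cent_ga : central ga. Proof. exact: central_scale. Qed.


Lemma central_mul_mono (z Y W : D) r : central z ->
  z * (Y * z ^+ r * W) = Y * z ^+ r.+1 * W.
Proof. by move=> cz; rewrite !mulrA (cz Y) -(mulrA Y z) -exprS. Qed.

Lemma A_mono i j k r s t : A * mono i j k r s t = mono i.+1 j k r s t.
Proof. by rewrite /mono !mulrA -exprS. Qed.

Lemma B_mono j k r s t : B * mono 0 j k r s t = mono 0 j.+1 k r s t.
Proof. by rewrite /mono !expr0 !mul1r !mulrA -exprS. Qed.

Lemma C_mono k r s t : C * mono 0 0 k r s t = mono 0 0 k.+1 r s t.
Proof. by rewrite /mono !expr0 !mul1r !mulrA -exprS. Qed.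

Lemma al_mono i j k r s t : al * mono i j k r s t = mono i j k r.+1 s t.
Proof.
rewrite /mono -[_ * be ^+ s * _]mulrA central_mul_mono; last exact: cent_al.
by rewrite !mulrA.
Qed.

Lemma be_mono i j k r s t : be * mono i j k r s t = mono i j k r s.+1 t.
Proof. by rewrite /mono central_mul_mono; last exact: cent_be. Qed.

Lemma ga_mono i j k r s t : ga * mono i j k r s t = mono i j k r s t.+1.
Proof.
by rewrite /mono -[LHS]mulr1 -mulrA central_mul_mono ?mulr1; last exact: cent_ga.
Qed.

Lemma A_Mspan n x : Mspan n x -> Mspan n.+1 (A * x).
Proof.
apply: span_mull => _ [i [j [k [r [s [t [h ->]]]]]]]; rewrite A_mono.
by apply: span_gen; exists i.+1, j, k, r, s, t.
Qed.

Lemma al_Mspan n x : Mspan n x -> Mspan n.+1 (al * x).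
Proof.
apply: span_mull => _ [i [j [k [r [s [t [h ->]]]]]]]; rewrite al_mono.
by apply: span_gen; exists i, j, k, r.+1, s, t; split=> //; lia.
Qed.

Lemma be_Mspan n x : Mspan n x -> Mspan n.+1 (be * x).
Proof.
apply: span_mull => _ [i [j [k [r [s [t [h ->]]]]]]]; rewrite be_mono.
by apply: span_gen; exists i, j, k, r, s.+1, t; split=> //; lia.
Qed.

Lemma ga_Mspan n x : Mspan n x -> Mspan n.+1 (ga * x).
Proof.
apply: span_mull => _ [i [j [k [r [s [t [h ->]]]]]]]; rewrite ga_mono.
by apply: span_gen; exists i, j, k, r, s, t.+1; split=> //; lia.
Qed.

Lemma swap_Mspan n (X Y Z xi x : D) :
    (exists c d e : F, Z * Y = c *: (Y * Z) + d *: X - e *: xi) ->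
    Mspan n.+1 (Y * (Z * x)) -> Mspan n.+1 (X * x) -> Mspan n.+1 (xi * x) ->
  Mspan n.+1 (Z * (Y * x)).
Proof.
move=> [c [d [e ZY]]] hY hX hxi.
rewrite mulrA ZY mulrBl mulrDl -!scalerAl -mulrA.
by apply: spanB (spanZ _ hxi); apply: spanD; apply: spanZ.
Qed.

(** The two claims are intertwined: moving [B] past [A] produces [C], and moving [C] past [A]
    produces [B]. The extra terms have lower degree, so induction on [n] handles them. *)
Lemma BC_Mspan n :
  (forall x, Mspan n x -> Mspan n.+1 (B * x)) /\
  (forall x, Mspan n x -> Mspan n.+1 (C * x)).
Proof.
elim: n => [|n [IHB IHC]].
  have is1 x : is_mono 0 x -> x = mono 0 0 0 0 0 0.
    by move=> [[|i] [[|j] [[|k] [[|r] [[|s] [[|t] [//]]]]]]].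
  split; apply: span_mull => x /is1 ->; apply: span_gen.
    by rewrite B_mono; exists 0%N, 1%N, 0%N, 0%N, 0%N, 0%N.
  by rewrite C_mono; exists 0%N, 0%N, 1%N, 0%N, 0%N, 0%N.
(* [B] goes first: moving [C] past [B] leaves [B * (C * y)] with [C * y] of degree [n.+1], which
   requires the claim for [B] already at [n.+1]. *)
have {}IHB x : Mspan n.+1 x -> Mspan n.+2 (B * x).
  apply: span_mull => _ [[|i] [j [k [r [s [t [h ->]]]]]]].
    rewrite B_mono; apply: span_gen.
    by exists 0%N, j.+1, k, r, s, t; split=> //; lia.
  rewrite -A_mono; have hy : Mspan n (mono i j k r s t).
    by apply: span_gen; exists i, j, k, r, s, t.
  apply: (swap_Mspan (aw_elt_swap C A B)).
  - exact/A_Mspan/IHB.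
  - exact/Mspan_leq/IHC.
  - by apply: (@Mspan_leq n.+1) => //; apply: ga_Mspan.
split=> //; apply: span_mull => _ [[|i] [j [k [r [s [t [h ->]]]]]]]; last first.
  rewrite -A_mono; have hy : Mspan n (mono i j k r s t).
    by apply: span_gen; exists i, j, k, r, s, t.
  apply: (swap_Mspan (aw_elt_swapV B C A)).
  - exact/A_Mspan/IHC.
  - exact/IHB/Mspan_leq/hy.
  - by apply: (@Mspan_leq n.+1) => //; apply: be_Mspan.
case: j h => [|j] h.
  rewrite C_mono; apply: span_gen.
  by exists 0%N, 0%N, k.+1, r, s, t; split=> //; lia.
rewrite -B_mono; have hy : Mspan n (mono 0 j k r s t).
  by apply: span_gen; exists 0%N, j, k, r, s, t; split=> //; lia.
apply: (swap_Mspan (aw_elt_swap A B C)).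
- exact/IHB/IHC.
- by apply: (@Mspan_leq n.+1) => //; apply: A_Mspan.
- by apply: (@Mspan_leq n.+1) => //; apply: al_Mspan.
Qed.

(** Left multiplication by any generator of [Delta1] raises the degree by at most one. *)
Lemma Delta_sub_Mspan n x : Delta q A B C n x -> Mspan n x.
Proof.
elim: n x => [|n IHn].
  apply: span_sub => _ ->; apply: span_gen.
  by exists 0%N, 0%N, 0%N, 0%N, 0%N, 0%N; rewrite /mono !expr0 !mulr1.
apply: span_sub => _ [h [y [hh /IHn hy ->]]]; move: h hh.
apply: span_mulr => h [|[|[|[|[|[|]]]]]] ->.
- by rewrite mul1r; apply: Mspan_leq hy.
- exact: A_Mspan.
- exact: (proj1 (BC_Mspan n)).
- exact: (proj2 (BC_Mspan n)).
- exact: al_Mspan.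
- exact: be_Mspan.
- exact: ga_Mspan.
Qed.

Lemma Delta_mul n g x : Delta1 q A B C g -> Delta q A B C n x ->
  Delta q A B C n.+1 (g * x).
Proof. by move=> hg hx; apply: span_gen; exists g, x. Qed.

(** The first factor with nonzero exponent is peeled off on the left; centrality brings [al], [be],
    [ga] to the front. *)
Lemma Delta_mono n i j k r s t : (i + j + k + r + s + t <= n)%N ->
  Delta q A B C n (mono i j k r s t).
Proof.
have gen y : [\/ y = 1, y = A, y = B | y = C] \/
             [\/ y = al, y = be | y = ga] -> Delta1 q A B C y.
  by move=> h; apply: span_gen; case: h => [[]|[]] ->; tauto.
elim: n i j k r s t => [|n IHn] i j k r s t h.
  case: i j k r s t h => [|?] [|?] [|?] [|?] [|?] [|?] // _.
  by apply: span_gen; rewrite /mono !expr0 !mulr1.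
case: i h => [|i] h.
  2: by rewrite -A_mono; apply: Delta_mul (IHn _ _ _ _ _ _ _);
       [apply: gen; left; constructor 2 | lia].
case: j h => [|j] h.
  2: by rewrite -B_mono; apply: Delta_mul (IHn _ _ _ _ _ _ _);
       [apply: gen; left; constructor 3 | lia].
case: k h => [|k] h.
  2: by rewrite -C_mono; apply: Delta_mul (IHn _ _ _ _ _ _ _);
       [apply: gen; left; constructor 4 | lia].
case: r h => [|r] h.
  2: by rewrite -al_mono; apply: Delta_mul (IHn _ _ _ _ _ _ _);
       [apply: gen; right; constructor 1 | lia].
case: s h => [|s] h.
  2: by rewrite -be_mono; apply: Delta_mul (IHn _ _ _ _ _ _ _);
       [apply: gen; right; constructor 2 | lia].
case: t h => [|t] h.
  2: by rewrite -ga_mono; apply: Delta_mul (IHn _ _ _ _ _ _ _);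
       [apply: gen; right; constructor 3 | lia].
(* No factor is left to peel off; the factor 1 in [Delta1] raises the level instead. *)
rewrite -[mono _ _ _ _ _ _]mul1r; apply: Delta_mul (IHn _ _ _ _ _ _ _) => //.
by apply: gen; left; constructor 1.
Qed.

End Spanning.

(** * Linear independence through the representation on arrays *)

Section Independence.
Variables (F : fieldType) (q : F) (D : algType F) (A B C : D).
Hypotheses (q_neq0 : q != 0) (q4_neq1 : q ^+ 4 != 1).
Hypothesis univ : is_universal_AW q A B C.

Local Notation R := {mpoly F[4]}.
(** The four variables stand for [lam], [al], [be], [ga], in this order. *)
Local Notation x0 := ('X_[U_(inord 0)] : R).
Local Notation x1 := ('X_[U_(inord 1)] : R).
Local Notation x2 := ('X_[U_(inord 2)] : R).
Local Notation x3 := ('X_[U_(inord 3)] : R).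

Lemma mcoeff_monomial i r s t i' r' s' t' :
  (x0 ^+ i * x1 ^+ r * x2 ^+ s * x3 ^+ t)@_(U_(inord 0) *+ i' + U_(inord 1) *+ r'
     + U_(inord 2) *+ s' + U_(inord 3) *+ t')%MM
  = ((i, r, s, t) == (i', r', s', t'))%:R.
Proof.
rewrite !mpolyXn -!mpolyXD mcoeffX; congr (nat_of_bool _)%:R.
apply/eqP/eqP => [/mnmP h|[-> -> -> ->] //].
move: (h (inord 0)) (h (inord 1)) (h (inord 2)) (h (inord 3)).
rewrite !mnmDE !mulmnE !mnm1E -!val_eqE /= !inordK //= !mul1n !mul0n !addn0 !add0n.
by move=> -> -> -> ->.
Qed.

Lemma aw_elt_morph (E : algType F) (phi : {lrmorphism D -> E}) X Y Z :
  phi (aw_elt q X Y Z) = aw_elt q (phi X) (phi Y) (phi Z).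
Proof. by rewrite /aw_elt linearD linearZ /= linearB !linearZ /= !rmorphM. Qed.

Lemma mono_morph (E : algType F) (phi : {lrmorphism D -> E}) i j k r s t :
  phi (mono q A B C i j k r s t) =
  mono q (phi A) (phi B) (phi C) i j k r s t.
Proof.
rewrite /mono !rmorphM !rmorphXn /= /aw_alpha /aw_beta /aw_gamma !linearZ /=.
by rewrite /aw_a /aw_b /aw_c !aw_elt_morph.
Qed.

Lemma mono_free n (c : expo n -> F) :
  \sum_(e | expo_ok e) c e *: aw_mono q A B C e = 0 ->
  forall e, expo_ok e -> c e = 0.
Proof.
case: univ => _ _ _ /(_ _ _ _ _
  (aw_rel_rep x0 x1 x2 x3 q_neq0 q4_neq1)) [phi [phiA phiB phiC]] _ sum0.
case=> [[[[[i0 j0] k0] r0] s0] t0] e0_ok.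
(* This indicator array isolates the exponents of [B] and [C]; the polynomial coefficient taken
   below isolates the other four. *)
pose f : nat -> nat -> R := fun j k => ((j == j0) && (k == k0))%:R.
have ev0 : phi 0 f 0 0 = 0 by rewrite linear0.
have evD x y : phi (x + y) f 0 0 = phi x f 0 0 + phi y f 0 0 by rewrite linearD.
have evZ a x : phi (a *: x) f 0 0 = a *: phi x f 0 0 by rewrite linearZ.
have := congr1 (fun x => (phi x f 0 0)@_(U_(inord 0) *+ i0 + U_(inord 1) *+ r0
     + U_(inord 2) *+ s0 + U_(inord 3) *+ t0)%MM) sum0.
rewrite /= ev0 mcoeff0 (big_morph _ evD ev0) linear_sum /=.
rewrite (bigD1 (i0, j0, k0, r0, s0, t0)) //= big1 ?addr0.
  rewrite evZ -/(mono q A B C i0 j0 k0 r0 s0 t0) mono_morph phiA phiB phiC.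
  rewrite /mono (mono_rep _ _ _ _ q_neq0 q4_neq1).
  by rewrite mcoeffZ /f !eqxx mulr1 mcoeff_monomial eqxx mulr1.
case=> [[[[[i j] k] r] s] t] /andP[_ ne].
rewrite evZ -/(mono q A B C i j k r s t) mono_morph phiA phiB phiC.
rewrite /mono (mono_rep _ _ _ _ q_neq0 q4_neq1).
(* Another monomial contributes 0: either the array entry vanishes, or (j, k) agrees and the
   polynomial monomials differ. *)
rewrite mcoeffZ /f; case: andP => [[/eqP/val_inj ej /eqP/val_inj ek]|_]; last first.
  by rewrite mulr0 mcoeff0 mulr0.
rewrite mulr1 mcoeff_monomial; case: eqP => [[/val_inj ei /val_inj er /val_inj es /val_inj et]|_].
  by rewrite ei ej ek er es et eqxx in ne.
by rewrite mulr0.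
Qed.

End Independence.

(** Passage to the finite index type: a total degree at most [n] bounds each exponent by [n]. *)
Lemma Mspan_expo (F : fieldType) (q : F) (D : algType F) (A B C : D) n x :
  span (is_mono q A B C n) x <->
  exists c : expo n -> F, x = \sum_(e | expo_ok e) c e *: aw_mono q A B C e.
Proof.
split; last first.
  move=> [c ->]; apply: span_sum => -[[[[[i j] k] r] s] t] h.
  by exists i, j, k, r, s, t.
move: x; apply: span_min.
- by exists (fun=> 0); rewrite big1 // => e _; rewrite scale0r.
- move=> a _ _ [c ->] [d ->]; exists (fun e => a * c e + d e).
  rewrite scaler_sumr -big_split; apply: eq_bigr => e _.
  by rewrite scalerDl scalerA.
move=> _ [i [j [k [r [s [t [h ->]]]]]]].
have [[hi hj hk hr hs] ht] : [/\ i < n.+1, j < n.+1, k < n.+1,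
    r < n.+1 & s < n.+1]%N /\ (t < n.+1)%N.
  by split; [split|]; lia.
pose e0 : expo n := (Ordinal hi, Ordinal hj, Ordinal hk, Ordinal hr, Ordinal hs, Ordinal ht).
exists (fun e => (e == e0)%:R).
rewrite (bigD1 e0) //= eqxx scale1r big1 ?addr0 // => e /andP[_ /negPf ->].
by rewrite scale0r.
Qed.

Theorem theorem5p4 (F : fieldType) (q : F) (hq0 : q != 0) (hq4 : q ^+ 4 != 1)
  (D : algType F) (A B C : D) (hU : is_universal_AW q A B C) (n : nat) :
  is_basis_of (Delta q A B C n) (@expo_ok n) (@aw_mono F q D A B C n).
Proof.
have [cent_a cent_b cent_c _ _] := hU; split; last exact: (mono_free hq0 hq4 hU).
move=> x; rewrite -Mspan_expo; split.
  exact: (Delta_sub_Mspan hq0 hq4 cent_a cent_b cent_c).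
(* [Delta] unfolds to a span only once [n] is 0 or a successor, which [span_sub] requires. *)
case: n => [|n]; (apply: span_sub => _ [i [j [k [r [s [t [h ->]]]]]]]).
  exact: (Delta_mono hq0 hq4 cent_a cent_b cent_c h).
exact: (Delta_mono hq0 hq4 cent_a cent_b cent_c h).
Qed.
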